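(* Let $S\subseteq\{-1,1\}^n$ and let $f:S\to\{-1,1\}^n$ be a bi-Lipschitz bijection of $S$. Then there exists a real orthogonal $n\times n$ matrix $M$ such that $M\mathbf{x}=f(\mathbf{x})$ for all $\mathbf{x}\in S$.
   Context: For $\mathbf{x},\mathbf{y}\in\{-1,1\}^n$, the Hamming distance $\Delta(\mathbf{x},\mathbf{y})$ is the number of coordinates on which they differ. Given $S\subseteq\{-1,1\}^n$, a function $f:S\to\{-1,1\}^n$ is called a bi-Lipschitz bijection of $S$ if $\Delta(f(\mathbf{x}),f(\mathbf{y}))=\Delta(\mathbf{x},\mathbf{y})$ for all $\mathbf{x},\mathbf{y}\in S$. Elements of $\{-1,1\}^n$ are regarded as vectors in $\mathbf{R}^n$. *)

(* Defs.v *)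
From mathcomp Require Import all_boot all_order all_algebra.
From mathcomp Require Import boolp classical_sets functions reals.
Set Implicit Arguments.
Unset Strict Implicit.
Unset Printing Implicit Defensive.
Import Order.TTheory GRing.Theory Num.Theory.
Local Open Scope classical_set_scope.
Local Open Scope ring_scope.

Definition hypercube (R : realType) (n : nat) : set 'cV[R]_n :=
  [set x | forall i, x i 0 = -1 \/ x i 0 = 1].
Arguments hypercube : clear implicits.

Definition hamming (R : realType) (n : nat) (x y : 'cV[R]_n) : nat :=
  #|[pred i | x i 0 != y i 0]|.

(* A function S -> {-1,1}^n is rendered as a total function on R^n, of which
   only the values on S are constrained. *)
Definition bilipschitz_bijection (R : realType) (n : nat) (S : set 'cV[R]_n)
    (f : 'cV[R]_n -> 'cV[R]_n) : Prop :=
  forall x y, S x -> S y -> hamming (f x) (f y) = hamming x y.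

Definition orthogonal_mx (R : realType) (n : nat) (M : 'M[R]_n) : Prop :=
  M^T *m M = 1%:M.

(* Main.v *)
Require Import Defs.
From mathcomp Require Import all_boot all_order all_algebra.
From mathcomp Require Import boolp classical_sets functions reals.
From mathcomp Require Import ring.
Set Implicit Arguments.
Unset Strict Implicit.
Unset Printing Implicit Defensive.
Import Order.TTheory GRing.Theory Num.Theory.
Local Open Scope classical_set_scope.
Local Open Scope ring_scope.

(** On the hypercube the inner product is an affine function of the Hamming
distance, [dot x y = n - 2 * hamming x y] ([dot_hypercube]), so a map that
preserves Hamming distances preserves inner products.

It remains to extend an inner-product-preserving map of a finite family of
vectors to an orthogonal matrix ([orthogonal_extension]).  The matrix is a
product of reflections, built one vector at a time.  Suppose that an orthogonal
[M] agrees with [f] on the vectors already treated, and let [x] be a new one.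
The vectors [M x] and [f x] have the same length, and the same inner product
with every [f y] for [y] already treated.  Hence the reflection along
[M x - f x] exchanges [M x] and [f x] and fixes each such [f y], and composing
it with [M] treats [x] as well.  No basis of the span has to be chosen, and
dependent or repeated vectors need no special care. *)

Definition dot (R : pzSemiRingType) (n : nat) (x y : 'cV[R]_n) : R :=
  \sum_i x i 0 * y i 0.

Lemma mulmx_tr_dot (R : pzSemiRingType) (n : nat) (x y : 'cV[R]_n) :
  x^T *m y = (dot x y)%:M.
Proof.
rewrite [LHS]mx11_scalar; congr _%:M; rewrite mxE.
by apply: eq_bigr => i _; rewrite mxE.
Qed.

Lemma dotC (R : comPzRingType) (n : nat) (x y : 'cV[R]_n) : dot x y = dot y x.
Proof. by apply: eq_bigr => i _; rewrite mulrC. Qed.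

Lemma dotBl (R : pzRingType) (n : nat) (x y z : 'cV[R]_n) :
  dot (x - y) z = dot x z - dot y z.
Proof. by rewrite /dot -sumrB; apply: eq_bigr => i _; rewrite !mxE mulrBl. Qed.

Lemma dotBr (R : pzRingType) (n : nat) (x y z : 'cV[R]_n) :
  dot z (x - y) = dot z x - dot z y.
Proof. by rewrite /dot -sumrB; apply: eq_bigr => i _; rewrite !mxE mulrBr. Qed.

Lemma dot_eq0 (R : realDomainType) (n : nat) (x : 'cV[R]_n) :
  (dot x x == 0) = (x == 0).
Proof.
apply/idP/eqP => [|->]; last by rewrite /dot big1 // => i _; rewrite mxE mul0r.
rewrite psumr_eq0 => [/allP x0|i _]; last by rewrite -expr2 sqr_ge0.
apply/colP => i; rewrite mxE; apply/eqP.
by have := x0 i (mem_index_enum i); rewrite mulf_eq0 orbb.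
Qed.

Lemma dot_orthogonal (R : comPzRingType) (n : nat) (M : 'M[R]_n)
    (x y : 'cV[R]_n) :
  M^T *m M = 1%:M -> dot (M *m x) (M *m y) = dot x y.
Proof.
move=> MM; have : (M *m x)^T *m (M *m y) = x^T *m y.
  by rewrite trmx_mul mulmxA -(mulmxA x^T) MM mulmx1.
by rewrite !mulmx_tr_dot => /matrixP /(_ 0 0); rewrite !mxE.
Qed.

(** The orthogonal reflection along [w].  For [w = 0] the formula degenerates
to the identity, which is what a reflection exchanging two equal vectors
should be. *)
Definition reflection (R : fieldType) (n : nat) (w : 'cV[R]_n) : 'M[R]_n :=
  1%:M - (2 / dot w w) *: (w *m w^T).

Lemma reflectionE (R : fieldType) (n : nat) (w x : 'cV[R]_n) :
  reflection w *m x = x - (2 * dot w x / dot w w) *: w.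
Proof.
rewrite /reflection mulmxBl mul1mx -scalemxAl -mulmxA mulmx_tr_dot.
by rewrite mul_mx_scalar scalerA mulrAC.
Qed.

Lemma reflection_orthogonal (R : realFieldType) (n : nat) (w : 'cV[R]_n) :
  (reflection w)^T *m reflection w = 1%:M.
Proof.
have -> : (reflection w)^T = reflection w.
  by rewrite /reflection linearB linearZ /= trmx1 trmx_mul trmxK.
have [->|w0] := eqVneq w 0.
  by rewrite /reflection mul0mx scaler0 subr0 mulmx1.
have d0 : dot w w != 0 by rewrite dot_eq0.
rewrite {2}/reflection mulmxBr mulmx1 -scalemxAr mulmxA reflectionE.
(* A reflection negates its own direction. *)
have -> : w - (2 * dot w w / dot w w) *: w = - w.
  by rewrite mulfK // scaler_nat mulr2n opprD addNKr.
rewrite mulNmx scalerN opprK.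
by rewrite /reflection subrK.
Qed.

(** Equality of lengths makes the difference [u - v] satisfy
[dot (u - v) (u - v) = 2 * dot (u - v) u], so that reflecting [u] subtracts
exactly [u - v]. *)
Lemma reflection_swap (R : realFieldType) (n : nat) (u v : 'cV[R]_n) :
  dot u u = dot v v -> reflection (u - v) *m u = v.
Proof.
move=> uv; rewrite reflectionE.
have [w0|w0] := eqVneq (u - v) 0.
  by rewrite w0 scaler0 subr0; apply/eqP; rewrite -subr_eq0 w0.
have -> : 2 * dot (u - v) u = dot (u - v) (u - v).
  by rewrite dotBr !dotBl -uv (dotC v u); ring.
by rewrite divff ?dot_eq0 // scale1r subKr.
Qed.

Lemma reflection_fix (R : fieldType) (n : nat) (w x : 'cV[R]_n) :
  dot w x = 0 -> reflection w *m x = x.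
Proof. by move=> wx; rewrite reflectionE wx mulr0 mul0r scale0r subr0. Qed.

(** Finite families suffice here because the hypercube is finite; the list form
is what lets the matrix be built one reflection at a time. *)
Lemma orthogonal_extension (R : realFieldType) (n : nat) (s : seq 'cV[R]_n)
    (f : 'cV[R]_n -> 'cV[R]_n) :
  {in s &, forall x y, dot (f x) (f y) = dot x y} ->
  exists2 M : 'M[R]_n, M^T *m M = 1%:M & {in s, forall x, M *m x = f x}.
Proof.
elim: s => [|x s IHs] f_dot; first by exists 1%:M => //; rewrite trmx1 mulmx1.
have [y z ys zs|M MM Mf] := IHs; first by apply: f_dot; rewrite inE ?ys ?zs orbT.
exists (reflection (M *m x - f x) *m M) => [|y].
  rewrite trmx_mul mulmxA -(mulmxA M^T) reflection_orthogonal.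
  by rewrite mulmx1.
rewrite -mulmxA inE => /predU1P[->|ys].
  by apply: reflection_swap; rewrite dot_orthogonal // f_dot ?mem_head.
rewrite (Mf y ys); apply: reflection_fix.
rewrite dotBl -{1}(Mf y ys) dot_orthogonal // f_dot ?subrr ?mem_head //.
by rewrite inE ys orbT.
Qed.

(** Each coordinate contributes [1] to the inner product where [x] and [y]
agree and [-1] where they differ. *)
Lemma dot_hypercube (R : realType) (n : nat) (x y : 'cV[R]_n) :
  hypercube R n x -> hypercube R n y -> dot x y = n%:R - 2 * (hamming x y)%:R.
Proof.
move=> xQ yQ; rewrite /hamming -sum1_card natr_sum mulr_sumr big_mkcond /=.
rewrite -[n in n%:R]card_ord -sum1_card natr_sum -sumrB.
apply: eq_bigr => i _; rewrite inE.
case: eqVneq => [<-|] /=; first by case: (xQ i) => ->; ring.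
by case: (xQ i) => ->; case: (yQ i) => ->; rewrite ?eqxx // => _; ring.
Qed.

Lemma hypercube_enum (R : realType) (n : nat) :
  exists s : seq 'cV[R]_n, forall x, hypercube R n x -> x \in s.
Proof.
exists [seq \col_i (if e i then 1 else -1) | e : {ffun 'I_n -> bool}] => x xQ.
apply/mapP; exists [ffun i => x i 0 == 1]; first by rewrite mem_enum.
apply/colP => i; rewrite mxE ffunE.
by case: eqP => // x1; case: (xQ i).
Qed.

Theorem proposition1p5 (R : realType) (n : nat) (S : set 'cV[R]_n)
    (f : 'cV[R]_n -> 'cV[R]_n)
    (S_cube : S `<=` hypercube R n)
    (f_cube : set_fun S (hypercube R n) f)
    (f_bilip : bilipschitz_bijection S f) :
  exists M : 'M[R]_n,
    orthogonal_mx M /\ (forall x, S x -> M *m x = f x).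
Proof.
have [s sP] := hypercube_enum R n.
have [x y|M MM Mf] := @orthogonal_extension R n [seq x <- s | `[< S x >]] f.
  rewrite !mem_filter => /andP[/asboolP Sx _] /andP[/asboolP Sy _].
  rewrite !dot_hypercube ?f_bilip //; by [apply: S_cube | apply: f_cube].
exists M; split=> // x Sx; apply: Mf.
by rewrite mem_filter sP ?andbT; [apply/asboolP | apply: S_cube].
Qed.
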